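(* For every integer $m\geq 3$, the variety $\mathbf{V}_m$ of $m$-commutative BCK-algebras is not determined by the identity $x_m=y_m$; that is, $\mathbf{V}_m$ is not equal to the class of all BCK-algebras $(X,\cdot,0)$ such that for all $x,y\in X$ the BCK-sequences $(x_k)_{k\ge 0}$ and $(y_k)_{k\ge 0}$ determined by $x$ and $y$ satisfy $x_m=y_m$.
   Context: A BCK-algebra is an algebra $(X,\cdot,0)$, where $X$ is a non-empty set with a designated element $0$ and a binary operation $\cdot$ such that for all $x,y,z\in X$: (1) $((x\cdot y)\cdot(z\cdot y))\cdot(x\cdot z)=0$; (2) $(x\cdot(x\cdot y))\cdot y=0$; (3) $x\cdot 0=x$; (4) $0\cdot x=0$; (5) $x\cdot y=y\cdot x=0$ implies $x=y$. A BCK-algebra is partially ordered by the relation: $x\leq y$ iff $x\cdot y=0$. For elements $x,y$ of a BCK-algebra, the BCK-sequences determined by $x$ and $y$ are the sequences $(x_k)_{k\ge0}$, $(y_k)_{k\ge0}$ defined by $x_0=x$, $x_1=y\cdot(y\cdot x)$, $x_k=x_{k-2}\cdot(x_{k-2}\cdot x_{k-1})$ for $k\geq 2$; $y_0=y$, $y_1=x\cdot(x\cdot y)$, $y_k=y_{k-2}\cdot(y_{k-2}\cdot y_{k-1})$ for $k\geq 2$. For an integer $m\geq 1$, $\mathbf{V}_m$ denotes the class of all BCK-algebras $(X,\cdot,0)$ such that for every two elements $z_0,z_1\in X$ with $z_1\leq z_0$, the sequence defined by $z_k=z_{k-2}\cdot(z_{k-2}\cdot z_{k-1})$ for $k\geq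 2$ satisfies $z_m=z_{m+1}$. *)

(* Defs.v *)
Set Implicit Arguments.
Unset Strict Implicit.
Unset Printing Implicit Defensive.

Declare Scope bck_scope.
Open Scope bck_scope.

Record BCKalgebra := {
  carrier :> Type;
  op : carrier -> carrier -> carrier;
  zero : carrier;
  bck1 : forall x y z, op (op (op x y) (op z y)) (op x z) = zero;
  bck2 : forall x y, op (op x (op x y)) y = zero;
  bck3 : forall x, op x zero = x;
  bck4 : forall x, op zero x = zero;
  bck5 : forall x y, op x y = zero /\ op y x = zero -> x = y
}.

Arguments zero {_}.

Notation "x ⋅ y" := (op x y) (at level 40, left associativity) : bck_scope.

Definition bck_le (X : BCKalgebra) (x y : X) : Prop := x ⋅ y = zero.

Notation "x ≼ y" := (bck_le x y) (at level 70, no associativity) : bck_scope.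

Fixpoint bck_seq (X : BCKalgebra) (z0 z1 : X) (k : nat) {struct k} : X :=
  match k with
  | 0 => z0
  | S k1 =>
      match k1 with
      | 0 => z1
      | S k2 =>
          bck_seq z0 z1 k2 ⋅ (bck_seq z0 z1 k2 ⋅ bck_seq z0 z1 k1)
      end
  end.

Definition xseq (X : BCKalgebra) (x y : X) : nat -> X :=
  bck_seq x (y ⋅ (y ⋅ x)).

Definition yseq (X : BCKalgebra) (x y : X) : nat -> X :=
  bck_seq y (x ⋅ (x ⋅ y)).

(* Classes of BCK-algebras are predicates on [BCKalgebra]. *)
Definition V (m : nat) (X : BCKalgebra) : Prop :=
  forall z0 z1 : X, z1 ≼ z0 -> bck_seq z0 z1 m = bck_seq z0 z1 (m + 1).

Definition class_xm_eq_ym (m : nat) (X : BCKalgebra) : Prop :=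
  forall x y : X, xseq x y m = yseq x y m.

Definition same_class (K L : BCKalgebra -> Prop) : Prop :=
  forall X : BCKalgebra, K X <-> L X.

(* Main.v *)
From Stdlib Require Import PeanoNat.
Require Import Defs.

(** Every BCK-sequence, once two consecutive terms agree, is constant.  Hence a
    single algebra settles all [m >= 3]: a 6-element algebra in [V 3] with two
    elements [A], [B] whose BCK-sequences are [A, E, E, E, ...] and
    [B, D, E, C, C, ...]. *)

Lemma bck_opxx (X : BCKalgebra) (x : X) : x ⋅ x = zero.
Proof. now rewrite <- (bck2 x zero), !bck3. Qed.

(** After two equal terms [u], the recursion gives [u ⋅ (u ⋅ u) = u ⋅ zero = u]. *)
Lemma bck_seq_stable (X : BCKalgebra) (z0 z1 : X) (k m : nat) :
  k <= m -> bck_seq z0 z1 k = bck_seq z0 z1 (S k) ->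
  bck_seq z0 z1 m = bck_seq z0 z1 k /\ bck_seq z0 z1 (S m) = bck_seq z0 z1 k.
Proof.
  intros le_km eq_k. induction le_km as [|m _ [IH IHS]].
  - now split.
  - split; [exact IHS|].
    change (bck_seq z0 z1 (S (S m)))
      with (bck_seq z0 z1 m ⋅ (bck_seq z0 z1 m ⋅ bck_seq z0 z1 (S m))).
    now rewrite IH, IHS, bck_opxx, bck3.
Qed.

Lemma V_mono (X : BCKalgebra) (k m : nat) : k <= m -> V k X -> V m X.
Proof.
  intros le_km Vk z0 z1 le_z.
  pose proof (Vk z0 z1 le_z) as eq_k. rewrite Nat.add_1_r in eq_k |- *.
  destruct (bck_seq_stable _ _ _ _ _ le_km eq_k). congruence.
Qed.

Inductive six := O | C | E | D | A | B.

(* Found by computer search. The order is the chain O < C < E < D below the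
   incomparable elements A and B. *)
Definition six_op (u v : six) : six :=
  match u, v with
  | O, _ => O
  | _, O => u
  | C, _ => O
  | E, C => C
  | E, _ => O
  | D, (C | E) => C
  | D, _ => O
  | A, C => D
  | A, E => E
  | A, (D | B) => C
  | A, _ => O
  | B, C => E
  | B, (E | D | A) => C
  | B, _ => O
  end.

Definition six_bck : BCKalgebra.
Proof.
  refine (@Build_BCKalgebra six six_op O _ _ _ _ _).
  - now intros [] [] [].
  - now intros [] [].
  - now intros [].
  - now intros [].
  - now intros [] [] [].
Defined.

Lemma six_V3 : V 3 six_bck.
(* All 36 pairs are computed: either [z1 ≼ z0] fails or terms 3 and 4 coincide. *)
Proof. now intros [] []. Qed.

Theorem theorem2 (m : nat) (hm : 3 <= m) :
  ~ same_class (V m) (class_xm_eq_ym m).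
Proof.
  intros same.
  pose proof (proj1 (same six_bck) (V_mono _ _ _ hm six_V3)
                (A : six_bck) (B : six_bck)) as eq_m.
  (* [eq_refl] computes terms 3 and 4: both [E] here, both [C] for the start [B], [D]. *)
  destruct (bck_seq_stable six_bck A E 3 m hm eq_refl) as [eq_x _].
  destruct (bck_seq_stable six_bck B D 3 m hm eq_refl) as [eq_y _].
  (* The second terms are [B ⋅ (B ⋅ A) = B ⋅ C = E] and [A ⋅ (A ⋅ B) = A ⋅ C = D]. *)
  change (bck_seq (A : six_bck) E m = bck_seq (B : six_bck) D m) in eq_m.
  rewrite eq_x, eq_y in eq_m.
  discriminate eq_m.
Qed.
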